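(* Let $1\le K\le N$ be integers. An urn contains $N$ objects, of which $K$ are good and $N-K$ are bad, and objects are drawn one at a time, uniformly at random and without replacement. Let $X$ be the number of draws up to and including the first good object. Then $$\mathrm{VAR}(X)=\frac{K(N-K)(N+1)}{(K+2)(K+1)^2}.$$
   Context: The probability mass function of $X$ is $P(n)=\frac{\binom{N-n+1}{K}}{\binom{N}{K}}\cdot\frac{K}{N-n+1}$ for $n=1,2,\ldots,N-K+1$, and $P(n)=0$ otherwise. $\mathrm{VAR}$ denotes the variance. *)

(* Defs.v *)
From HB Require Import structures.
From mathcomp Require Import all_boot all_order all_algebra.
From mathcomp Require Import all_classical all_reals all_analysis.
Set Implicit Arguments.
Unset Strict Implicit.
Unset Printing Implicit Defensive.
Import Order.TTheory GRing.Theory Num.Theory.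
Local Open Scope classical_set_scope.
Local Open Scope ring_scope.

(* U is the type of objects in the urn, Omega the sample space; the draws are
   indexed from 0, so [D i w] is the object obtained at draw number i + 1. *)

(* The objects still in the urn once the objects u 0, ..., u (k - 1) have been
   taken out. *)
Definition remaining (U : finType) (N : nat) (u : 'I_N -> U) (k : nat)
    : {set U} :=
  (~: [set u i | i : 'I_N & (i < k)%N])%SET.

Definition history (Omega : Type) (U : finType) (N : nat)
    (D : 'I_N -> Omega -> U) (u : 'I_N -> U) (k : nat) : set Omega :=
  [set w | forall i : 'I_N, (i < k)%N -> D i w = u i].

(* Conditionally on the first k draws, the next one is uniform on the objects
   that remain; the conditional probability is written in product form, so that
   histories of probability 0 need no special treatment. *)
Definition uniform_draws_without_replacement (d : measure_display)
    (Omega : measurableType d) (R : realType) (P : probability Omega R)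
    (U : finType) (N : nat) (D : 'I_N -> Omega -> U) : Prop :=
  (forall (i : 'I_N) (x : U), measurable [set w | D i w = x]) /\
  (forall (k : 'I_N) (u : 'I_N -> U) (x : U),
     P (history D u k `&` [set w | D k w = x]) =
     (P (history D u k) *
      ((x \in remaining u k)%:R / #|remaining u k|%:R)%:E)%E).

(* [find] is 0-based, hence the successor. If no good object is ever drawn, the
   value is N.+1; with at least one good object and #|U| = N this has
   probability 0. *)
Definition draws_to_first_good (Omega : Type) (U : finType) (N : nat)
    (G : {set U}) (D : 'I_N -> Omega -> U) (w : Omega) : nat :=
  (find (fun i : 'I_N => D i w \in G) (enum 'I_N)).+1.

(* Main.v *)
Require Import Defs.
From HB Require Import structures.
From mathcomp Require Import all_boot all_order all_algebra.
From mathcomp Require Import all_classical all_reals all_analysis.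
From mathcomp Require Import ring.
Import Order.TTheory GRing.Theory Num.Theory.
Local Open Scope classical_set_scope.
Local Open Scope ring_scope.

(** Let q k be the probability that the first k draws are all bad, that is,
    that X > k. Given k bad draws, in whatever order, N - k objects remain and all
    K good ones are among them, so the next draw is good with probability
    K / (N - k). Summing over histories ([all_bad_before_draw_good]) gives
    the recurrence [all_bad_before_rec]
<<
      (N - k) q (k + 1) = (N - k - K) q k,     q 0 = 1,
>>
    which determines the law of X.

    The expectation of a function f of X is f 0 plus a weighted sum of the
    q k, since
    f X = f 0 + sum over k < X of (f (k + 1) - f k) ([expectation_layers]).
    The weights that occur for the mean and the variance are polynomials of
    degree at most 1 in k. In the basis of rising factorials of N - k + 1 the
    recurrence makes these sums telescope:
<<
      (K + 1) q k = a k - a (k + 1),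
      (K + 2) (N - k + 1) q k = b k - b (k + 1),
      where a k = (N - k + 1) q k and b k = (N - k + 2) (N - k + 1) q k.
>>
    Hence the q k add up to the mean m = (N + 1) / (K + 1), and the second
    sum is (N + 1) (N + 2) / (K + 2). Applying the layer formula to
    f x = (x - m)^2 leaves a rational identity in N and K
    ([sum_survival_sqr_dev]). *)

(** * Probability and expectation over finitely many values *)

Lemma probability_fibers {d} {Omega : measurableType d} {R : realType}
    (P : probability Omega R) {V : finType} (f : Omega -> V) (A : set Omega) :
  measurable A -> (forall v, measurable (f @^-1` [set v])) ->
  P A = (\sum_(v : V) P (A `&` f @^-1` [set v]))%E.
Proof.
move=> mA mf.
rewrite fsbig_seq ?index_enum_uniq//= -measure_fin_bigcup//.
- congr (P _); apply/seteqP; split=> [w Aw|w [v _ []]//].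
  by exists (f w) => //=; exact: mem_index_enum.
- by move=> v1 v2 _ _ [w [[_ <-] [_ <-]]].
- by move=> v _; apply: measurableI.
Qed.

(** Telescoping f along 0, 1, ..., X w writes f (X w) as a finite combination
    of indicators of the tail events X > k, all of them integrable. Taking
    f x = (x - m)^2 gives a variance in one step. *)
Lemma expectation_layers {d} {Omega : measurableType d} {R : realType}
    (P : probability Omega R) {X : Omega -> nat} {n : nat} (f : nat -> R) :
  (forall w, (X w <= n)%N) ->
  (forall k, (k < n)%N -> measurable [set w | (k < X w)%N]) ->
  ('E_P[fun w => f (X w)] = (f 0%N +
    \sum_(k < n) (f k.+1 - f k) * fine (P [set w | (k < X w)%N]))%:E)%E.
Proof.
move=> Xn mX.
have fE w : f (X w) = f 0%N +
    \sum_(k < n) (f k.+1 - f k) * \1_[set w | (k < X w)%N] w.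
  have -> : \sum_(k < n) (f k.+1 - f k) * \1_[set w | (k < X w)%N] w =
      \sum_(0 <= k < X w) (f k.+1 - f k).
    rewrite (big_nat_widen _ _ _ _ _ (Xn w)) [RHS]big_mkcond /= big_mkord.
    apply: eq_bigr => k _; rewrite indicE.
    case: ifPn => kX; first by rewrite mem_set ?mulr1.
    by rewrite memNset ?mulr0//; exact/negP.
  by rewrite telescope_sumr // addrC subrK.
have mi (k : 'I_n) : P.-integrable setT
    (fun w => (f k.+1 - f k)%:E * (\1_[set w | (k < X w)%N] w)%:E)%E.
  by apply: integrableZl => //; apply: integrable_indic; exact: mX.
rewrite unlock.
under eq_integral do rewrite fE EFinD -sumEFin.
rewrite integralD//=; last 2 first.
- exact: finite_measure_integrable_cst.
- by apply: integrable_sum => // k _; under eq_fun do rewrite EFinM.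
rewrite integral_cst//= probability_setT mule1 EFinD -sumEFin; congr (_ + _)%E.
rewrite integral_sum//.
apply: eq_bigr => k _.
under eq_integral do rewrite EFinM.
rewrite integralZl//; last by apply: integrable_indic; exact: mX.
rewrite integral_indic ?setIT; [|exact: measurableT|exact: mX].
by rewrite EFinM fineK// fin_num_measure//; exact: mX.
Qed.

(** * The first draws being all bad *)

Definition all_bad_before {Omega : Type} {U : finType} {N : nat}
    (D : 'I_N -> Omega -> U) (G : {set U}) (k : nat) : set Omega :=
  [set w | forall i : 'I_N, (i < k)%N -> D i w \notin G].

Section Draws.
Context {d : measure_display} {Omega : measurableType d} {R : realType}.
Context {P : probability Omega R} {U : finType} {N : nat} {D : 'I_N -> Omega -> U}.
Hypothesis hU : #|U| = N.
Hypothesis hD : uniform_draws_without_replacement P D.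
Implicit Types (k : nat) (u : 'I_N -> U) (G : {set U}).

Let mD (i : 'I_N) (x : U) : measurable [set w | D i w = x].
Proof. exact: hD.1. Qed.

Lemma measurable_draw_in (i : 'I_N) (A : {set U}) : measurable [set w | D i w \in A].
Proof.
rewrite (_ : mkset _ = \bigcup_(x in [set` A]) [set w | D i w = x]).
  by apply: fin_bigcup_measurable => // x _; exact: mD.
by apply/seteqP; split=> [w Aw|w [x /= Ax ->]//]; exists (D i w).
Qed.

Lemma measurable_history u k : measurable (history D u k).
Proof.
rewrite (_ : history _ _ _ =
  \bigcap_(i in [set i : 'I_N | (i < k)%N]) [set w | D i w = u i]) //.
by apply: fin_bigcap_measurable => // i _; exact: mD.
Qed.

Lemma measurable_all_bad_before G k : measurable (all_bad_before D G k).
Proof.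
rewrite (_ : all_bad_before D G k =
  \bigcap_(i in [set i : 'I_N | (i < k)%N]) [set w | D i w \in (~: G)%SET]).
  by apply: fin_bigcap_measurable => // i _; exact: measurable_draw_in.
by apply/seteqP; split=> w /= h i /= /h /=; rewrite finset.in_setC.
Qed.

Lemma historyS u (i : 'I_N) :
  history D u i.+1 = history D u i `&` [set w | D i w = u i].
Proof.
apply/seteqP; split=> [w h|w [h hi] j /=].
  by split=> [j ji|/=]; apply: h => //; exact: ltnW.
by rewrite ltnS leq_eqVlt => /orP[/eqP/val_inj -> //|]; exact: h.
Qed.

Lemma remainingS u (i : 'I_N) :
  remaining u i.+1 = (remaining u i :\ u i)%SET.
Proof.
rewrite /remaining finset.setDE -finset.setCU; congr finset.setC.
apply/setP => x; rewrite !inE; apply/imsetP/orP => [[j]|].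
  rewrite inE ltnS leq_eqVlt => /orP[/eqP/val_inj -> ->|ji ->].
    by right; rewrite eqxx.
  by left; apply/imsetP; exists j; rewrite ?inE.
move=> [/imsetP[j]|/eqP ->]; last by exists i; rewrite ?inE.
by rewrite inE => ji ->; exists j; rewrite // inE ltnW.
Qed.

(** A history with a repeated object would leave more than N - k objects in
    the urn; such a history has probability 0, because drawing an object that
    is already out has conditional probability 0. *)
Lemma card_remaining u k : (k <= N)%N ->
  P (history D u k) != 0%E -> #|remaining u k| = (N - k)%N.
Proof.
elim: k => [_ _|k IH kN].
  rewrite subn0; apply: etrans hU; rewrite -cardsT; congr #|pred_of_set _|.
  by apply/setP => x; rewrite !inE; apply/imsetP => -[j]; rewrite inE.
rewrite (historyS u (Ordinal kN)) hD.2 mule_eq0 negb_or => /andP[hk].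
rewrite (remainingS u (Ordinal kN)) /= => hx.
have xr : u (Ordinal kN) \in remaining u k.
  by apply: contraNT hx => /negbTE ->; rewrite mul0r.
have := cardsD1 (u (Ordinal kN)) (remaining u k).
by rewrite xr IH ?(ltnW kN)// add1n subnS => ->.
Qed.

(** Histories of probability 0 satisfy this trivially, which is why the
    denominator can be N - k for every u, including those with repetitions. *)
Lemma history_draw_in u (k : 'I_N) (A : {set U}) : (A \subset remaining u k)%SET ->
  P (history D u k `&` [set w | D k w \in A]) =
  (P (history D u k) * (#|A|%:R / (N%:R - k%:R))%:E)%E.
Proof.
move=> /fintype.subsetP AR; have mH := measurable_history u k.
have [h0|h0] := eqVneq (P (history D u k)) 0%E.
  rewrite h0 mul0e; apply/eqP; rewrite eq_le measure_ge0 andbT -h0.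
  by apply: le_measure; rewrite ?inE//; apply: measurableI => //; exact: measurable_draw_in.
rewrite (probability_fibers P (D k)) => [||x]; last exact: mD.
  rewrite (eq_bigr (fun x => (P (history D u k) *
     ((x \in A)%:R / (N%:R - k%:R))%:E)%E)) => [|x _].
    rewrite -ge0_sume_distrr => [|x _].
      by rewrite sumEFin -mulr_suml -natr_sum -sum1_card [in RHS]big_mkcond.
    by rewrite lee_fin divr_ge0// subr_ge0 ler_nat ltnW.
  have [xA|xA] := boolP (x \in A); last first.
    rewrite mul0r mule0 (_ : _ `&` _ = set0) ?measure0//.
    by apply/seteqP; split=> // w /= [[_ +] xE]; rewrite xE (negbTE xA).
  rewrite -natrB ?(ltnW (ltn_ord k))// -(card_remaining u) ?(ltnW (ltn_ord k))//.
  rewrite -[in RHS](AR x xA) -hD.2; congr (P _).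
  by apply/seteqP; split=> w /= [] => [[]|hh xE] //; rewrite xE.
by apply: measurableI => //; exact: measurable_draw_in.
Qed.

(** The event that the first k draws are bad splits into histories, and the
    conditional probability given by [history_draw_in] is the same for all of
    them: none of the good objects has left the urn. *)
Lemma all_bad_before_draw_good G (k : 'I_N) :
  P (all_bad_before D G k `&` [set w | D k w \in G]) =
  (P (all_bad_before D G k) * (#|G|%:R / (N%:R - k%:R))%:E)%E.
Proof.
have mB := measurable_all_bad_before G k.
have mG := measurable_draw_in k G.
have [->|/finset.set0Pn[x0 x0G]] := eqVneq G finset.set0.
  rewrite cards0 mul0r mule0 (_ : _ `&` _ = set0) ?measure0//.
  by apply/seteqP; split=> // w /= []; rewrite inE.
(* f w records the first k draws; past them it takes the constant value x0, so
   that f has finitely many values and its nonempty fibres are histories. *)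
pose f w := [ffun i : 'I_N => if (i < k)%N then D i w else x0].
have fE w0 : f @^-1` [set f w0] = history D (f w0) k.
  apply/seteqP; split=> w /=.
    by move=> /ffunP e i ik; have := e i; rewrite !ffunE ik.
  move=> h; apply/ffunP => i; rewrite ffunE; case: ifP => ik.
    by rewrite (h _ ik).
  by rewrite ffunE ik.
have mf v : measurable (f @^-1` [set v]).
  have [->|/set0P[w <-]] := eqVneq (f @^-1` [set v]) set0; first exact: measurable0.
  by rewrite fE; exact: measurable_history.
rewrite (probability_fibers P f (all_bad_before D G k))//.
rewrite (probability_fibers P f)//; last exact: measurableI.
rewrite ge0_sume_distrl//; apply: eq_bigr => v _; rewrite setIAC.
have [->|/set0P[w [wB <-]]] := eqVneq (all_bad_before D G k `&` f @^-1` [set v]) set0.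
  by rewrite set0I measure0 mul0e.
have -> : all_bad_before D G k `&` f @^-1` [set f w] = history D (f w) k.
  rewrite fE; apply: setIidr => w' h i ik.
  by rewrite (h i ik) ffunE ik; exact: wB.
apply: history_draw_in.
apply/fintype.subsetP => x xG; rewrite inE; apply: contraL xG => /imsetP[i].
by rewrite inE ffunE => ik ->; rewrite ik; exact: wB.
Qed.

(** After k bad draws the next draw is bad or good; the good case has conditional
    probability #|G| / (N - k), given by [all_bad_before_draw_good]. *)
Lemma all_bad_before_rec G (k : 'I_N) :
  (N%:R - k%:R) * fine (P (all_bad_before D G k.+1)) =
  (N%:R - k%:R - #|G|%:R) * fine (P (all_bad_before D G k)).
Proof.
have mB := measurable_all_bad_before G.
have mG := measurable_draw_in k G.
have Nk : N%:R - k%:R != 0 :> R by rewrite subr_eq0 eqr_nat gtn_eqF.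
have /(congr1 fine) : P (all_bad_before D G k) =
    (P (all_bad_before D G k.+1) + P (all_bad_before D G k) * (#|G|%:R / (N%:R - k%:R))%:E)%E.
  rewrite -all_bad_before_draw_good -measureU//; last 2 first.
  - exact: measurableI.
  - apply/seteqP; split=> // w /= [h [_]].
    by rewrite (negbTE (h k _)).
  congr (P _); apply/seteqP; split=> [w h|w [h|[]//] i ik]; last first.
    by apply: h; exact: ltnW.
  have [kG|kG] := boolP (D k w \in G); [by right|left => i].
  rewrite ltnS leq_eqVlt => /orP[/eqP/val_inj -> //|]; exact: h.
have fP A : measurable A -> P A \is a fin_num by exact: fin_num_measure.
rewrite fineD ?fin_numM ?fP// fineM ?fP//=.
set a := fine _; set b := fine _ => e.
have -> : b = a - a * (#|G|%:R / (N%:R - k%:R)) by rewrite {1}e addrK.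
by field.
Qed.

End Draws.

(** * Telescoping sums of survival probabilities *)

Section SurvivalSums.
Context {F : numFieldType} {N K : nat} {q : nat -> F}.
Hypotheses (K_gt0 : (0 < K)%N) (KN : (K <= N)%N) (q0 : q 0%N = 1).
Hypothesis qS : forall k, (k < N)%N ->
  (N%:R - k%:R) * q k.+1 = (N%:R - k%:R - K%:R) * q k.

(** The factor N - k - K of the recurrence vanishes at k = N - K: after N - K
    bad draws only good objects remain. *)
Lemma survival_eq0 k : (N - K < k)%N -> (k <= N)%N -> q k = 0.
Proof.
elim: k => // k IH; rewrite ltnS => NKk kN.
have Nk : N%:R - k%:R != 0 :> F by rewrite subr_eq0 eqr_nat gtn_eqF.
apply: (mulfI Nk); rewrite qS// mulr0.
move: NKk; rewrite leq_eqVlt => /predU1P[<-|NKk].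
  by rewrite natrB//; ring.
by rewrite IH ?mulr0// ltnW.
Qed.

Lemma sum_survival : (K%:R + 1) * \sum_(k < N.+1) q k = N%:R + 1.
Proof.
(* The recurrence stops at k = N - 1; the last increment, at k = N, is right
   because q N = 0. *)
pose a k := - ((N%:R - k%:R + 1) * q k).
rewrite mulr_sumr -(big_mkord xpredT (fun k => (K%:R + 1) * q k)).
rewrite (eq_big_nat _ _ (F2 := fun k => a k.+1 - a k)) => [|k /=].
  by rewrite telescope_sumr// /a q0 -(natr1 N); ring.
rewrite ltnS leq_eqVlt => /predU1P[->|kN]; rewrite /a.
  by rewrite -(natr1 N) (@survival_eq0 N)//; [ring|rewrite ltn_subrL K_gt0 (leq_trans K_gt0)].
rewrite -(natr1 k).
have -> : N%:R - (k%:R + 1) + 1 = N%:R - k%:R :> F by ring.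
by rewrite qS//; ring.
Qed.

(** The weight N - k + 1, rather than k, is the one that telescopes: two
    consecutive values of (N - k + 2) (N - k + 1) q k share this factor. *)
Lemma sum_survival_linear :
  (K%:R + 2) * \sum_(k < N.+1) (N%:R - k%:R + 1) * q k = (N%:R + 1) * (N%:R + 2).
Proof.
pose a k := - ((N%:R - k%:R + 2) * ((N%:R - k%:R + 1) * q k)).
rewrite mulr_sumr.
rewrite -(big_mkord xpredT (fun k => (K%:R + 2) * ((N%:R - k%:R + 1) * q k))).
rewrite (eq_big_nat _ _ (F2 := fun k => a k.+1 - a k)) => [|k /=].
  by rewrite telescope_sumr// /a q0 -(natr1 N); ring.
rewrite ltnS leq_eqVlt => /predU1P[->|kN]; rewrite /a.
  by rewrite -(natr1 N) (@survival_eq0 N)//; [ring|rewrite ltn_subrL K_gt0 (leq_trans K_gt0)].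
rewrite -(natr1 k).
have -> : N%:R - (k%:R + 1) + 1 = N%:R - k%:R :> F by ring.
by rewrite qS//; ring.
Qed.

(** The increment of (k - m)^2 is 2 k + 1 - 2 m, that is,
    (2 N + 3 - 2 m) - 2 (N - k + 1), a combination of the two weights whose
    sums are known. *)
Lemma sum_survival_sqr_dev (m : F) : m = (N%:R + 1) / (K%:R + 1) ->
  m ^+ 2 + \sum_(k < N.+1) ((k.+1%:R - m) ^+ 2 - (k%:R - m) ^+ 2) * q k =
  (K%:R * (N%:R - K%:R) * (N%:R + 1)) / ((K%:R + 2) * (K%:R + 1) ^+ 2).
Proof.
have K1 : K%:R + 1 != 0 :> F by rewrite natr1 pnatr_eq0.
have K2 : K%:R + 2 != 0 :> F by rewrite -natrD pnatr_eq0 addn2.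
move=> mE.
have -> : \sum_(k < N.+1) ((k.+1%:R - m) ^+ 2 - (k%:R - m) ^+ 2) * q k =
    (2 * N%:R + 3 - 2 * m) * \sum_(k < N.+1) q k -
    2 * \sum_(k < N.+1) (N%:R - k%:R + 1) * q k.
  rewrite !mulr_sumr -sumrB; apply: eq_bigr => k _; rewrite -(natr1 k); ring.
have -> : \sum_(k < N.+1) q k = (N%:R + 1) / (K%:R + 1).
  by rewrite -sum_survival mulrC mulKf.
have -> : \sum_(k < N.+1) (N%:R - k%:R + 1) * q k =
    (N%:R + 1) * (N%:R + 2) / (K%:R + 2).
  by rewrite -sum_survival_linear mulrC mulKf.
by rewrite mE; field; rewrite K1 K2.
Qed.

End SurvivalSums.

(** * The variance of the waiting time *)

(** The bound k <= n matters: when no element satisfies p, [find] returns n. *)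
Lemma leq_find_enum_ord (n k : nat) (p : pred 'I_n) : (k <= n)%N ->
  (k <= find p (enum 'I_n))%N <-> (forall i : 'I_n, (i < k)%N -> ~~ p i).
Proof.
move=> kn; split=> [kf i ik|h].
  by rewrite -[i in p i](nth_ord_enum i) before_find// (leq_trans ik).
rewrite leqNgt; apply/negP => fk.
have hp : has p (enum 'I_n) by rewrite has_find size_enum_ord (leq_trans fk).
have fn : (find p (enum 'I_n) < n)%N by rewrite (leq_trans fk).
have := nth_find (Ordinal fn) hp.
rewrite -[X in nth _ _ X]/(nat_of_ord (Ordinal fn)) nth_ord_enum.
by apply/negP; exact: h.
Qed.

Theorem theorem2p8 (d : measure_display) (Omega : measurableType d)
    (R : realType) (P : probability Omega R) (N K : nat)
    (hK : (1 <= K)%N) (hKN : (K <= N)%N)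
    (U : finType) (hU : #|U| = N) (G : {set U}) (hG : #|G| = K)
    (D : 'I_N -> Omega -> U) (hD : uniform_draws_without_replacement P D) :
  ('V_P[fun w => (draws_to_first_good G D w)%:R] =
   ((K%:R * (N%:R - K%:R) * (N%:R + 1)) /
    ((K%:R + 2) * (K%:R + 1) ^+ 2))%:E)%E.
Proof.
pose q k := fine (P (all_bad_before D G k)).
have q0 : q 0%N = 1.
  rewrite /q (_ : all_bad_before D G 0 = setT) ?probability_setT//.
  by apply/seteqP; split=> // w _ i.
have qS k : (k < N)%N ->
    (N%:R - k%:R) * q k.+1 = (N%:R - k%:R - K%:R) * q k.
  by move=> kN; have := all_bad_before_rec hU hD G (Ordinal kN); rewrite hG.
pose X := draws_to_first_good G D.
have XN w : (X w <= N.+1)%N.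
  by rewrite ltnS (leq_trans (find_size _ _))// size_enum_ord.
have XE k : (k < N.+1)%N -> [set w | (k < X w)%N] = all_bad_before D G k.
  move=> kN; apply/seteqP; split=> w /=; rewrite ltnS => h.
    exact/leq_find_enum_ord.
  by apply/leq_find_enum_ord.
have EX (f : nat -> R) : ('E_P[fun w => f (X w)] =
    (f 0%N + \sum_(k < N.+1) (f k.+1 - f k) * q k)%:E)%E.
  rewrite (expectation_layers P f XN) => [|k kN].
    by congr (_ + _)%:E; apply: eq_bigr => k _; rewrite XE.
  by rewrite XE//; exact: measurable_all_bad_before hD G k.
rewrite /variance covariance.unlock.
have -> : ('E_P[fun w => (X w)%:R] = ((N%:R + 1) / (K%:R + 1))%:E)%E.
  rewrite (EX (fun n => n%:R)) add0r; congr EFin.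
  have K1 : K%:R + 1 != 0 :> R by rewrite natr1 pnatr_eq0.
  rewrite -(sum_survival hK hKN q0 qS) mulrC mulKf//.
  by apply: eq_bigr => k _; rewrite -(natr1 k) addrC addKr mul1r.
set m := fine _.
rewrite -(sum_survival_sqr_dev hK hKN q0 qS m erefl).
have := EX (fun n => (n%:R - m) ^+ 2).
by rewrite sub0r sqrrN.
Qed.
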